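(* Let $n\ge 2$ and let $\phi$ be a Maass form for $SL(n,\mathbb{Z})$ with Langlands parameters $(\alpha_1,\dots,\alpha_n)\in\mathbb{C}^n$. Let $1\le m\le n$ with $m\le 4$, and let $\mathcal{D}_{m,n}$ be the Casimir operator of order $m$ for $GL(n,\mathbb{R})$. Then $$\mathcal{D}_{m,n}\,\phi=\begin{cases}0 & \text{if } m=1,\\[2pt] \left(\sum_{\ell=1}^n\alpha_\ell^2-\frac{n^3-n}{12}\right)\phi & \text{if } m=2,\\[2pt] \left(\sum_{\ell=1}^n\alpha_\ell^3-\frac n2\sum_{\ell=1}^n\alpha_\ell^2+\frac{n^4-n^2}{24}\right)\phi & \text{if } m=3,\\[2pt] \left(\sum_{\ell=1}^n\alpha_\ell^4-n\sum_{\ell=1}^n\alpha_\ell^3+\frac12\sum_{\ell=1}^n\alpha_\ell^2-\frac{n^5-n}{80}\right)\phi & \text{if } m=4.\end{cases}$$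
   Context: Let $G=GL(n,\mathbb{R})$, $K=O(n,\mathbb{R})$, $Z(G)\cong\mathbb{R}^\times$ the center, $\mathfrak{h}^n=G/(K\cdot Z(G))$. Functions on $\mathfrak{h}^n$ are identified with right $K\cdot Z(G)$-invariant functions on $G$. Differential operators: for $X\in\mathfrak{gl}(n,\mathbb{R})$ and smooth $F:G\to\mathbb{C}$, $D_XF(g)=\frac{\partial}{\partial t}F(g(I+tX))\big|_{t=0}$. Let $E_{i,j}$ be the $n\times n$ matrix with $1$ in position $(i,j)$ and $0$ elsewhere, and $D_{i,j}:=D_{E_{i,j}}$. For $(i_1,\dots,i_m)\in\{1,\dots,n\}^m$, with $i_{m+1}:=i_1$, the composite $D_{i_1,i_2}\circ\cdots\circ D_{i_{m-1},i_m}\circ D_{i_m,i_1}$ is by convention the operator $$F\mapsto\Big(g\mapsto \frac{\partial^m}{\partial t_1\cdots\partial t_m}F\big(g\,(I+t_mE_{i_m,i_1})(I+t_{m-1}E_{i_{m-1},i_m})\cdots(I+t_1E_{i_1,i_2})\big)\Big|_{t_1=\dots=t_m=0}\Big),$$ i.e. the leftmost written operator $D_{i_1,i_2}$ is applied to $F$ first. Casimir operator of order $m$: $\mathcal{D}_{m,n}=\sum_{(i_1,\dots,i_m)\in\{1,\dots,n\}^m}D_{i_1,i_2}\circ\cdots\circ D_{i_{m-1},i_m}\circ D_{i_m,i_1}$. (For $m=1$ this is $\sum_i D_{i,i}$.) Power function: every $g\in G$ can be written $g=xyk$ (up to the center) with $x$ upper-triangular unipotent, $y=\mathrm{diag}(Y_1,\dots,Y_n)$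 with all $Y_i>0$, and $k\in K$. For $\beta\in\mathbb{C}^n$ with $\sum_i\beta_i=0$, the power function is $|g|^\beta:=\prod_{i=1}^nY_i^{\beta_i}$; it is a well-defined function on $\mathfrak{h}^n$ and a joint eigenfunction of all the $\mathcal{D}_{m,n}$. Maass form: a nonzero smooth cuspidal function $\phi\in\mathcal{L}^2(SL(n,\mathbb{Z})\backslash\mathfrak{h}^n)$ that is a joint eigenfunction of the Casimir operators $\mathcal{D}_{m,n}$, $1\le m\le n$. It has Langlands parameters $\alpha=(\alpha_1,\dots,\alpha_n)\in\mathbb{C}^n$, $\sum_\ell\alpha_\ell=0$, if for every $1\le m\le n$ the eigenvalue of $\mathcal{D}_{m,n}$ on $\phi$ equals the eigenvalue of $\mathcal{D}_{m,n}$ on $|\cdot|^{\alpha+\rho}$, where $\rho_i=\frac{n+1}{2}-i$ for $1\le i\le n$. *)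

(* Defs.v *)
From HB Require Import structures.
From mathcomp Require Import all_boot all_order all_algebra.
From mathcomp Require Import complex.
From mathcomp Require Import all_classical all_reals all_analysis.

Set Implicit Arguments.
Unset Strict Implicit.
Unset Printing Implicit Defensive.

Import Order.TTheory GRing.Theory Num.Theory.
Import numFieldNormedType.Exports.

Local Open Scope classical_set_scope.
Local Open Scope ring_scope.
Local Open Scope complex_scope.

(* Functions on G = GL(n,R) are total functions on 'M[R]_n of which only the
   values on unitmx (an open set) are ever used. *)

Section DifferentialOperators.
Variables (R : realType) (n : nat).
Implicit Types (F : 'M[R]_n -> R[i]) (g X : 'M[R]_n).

Definition Dop X F : 'M[R]_n -> R[i] := fun g =>
  derive1 (fun t : R => complex.Re (F (g *m (1%:M + t *: X)))) 0 +i*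
  derive1 (fun t : R => complex.Im (F (g *m (1%:M + t *: X)))) 0.

Definition Dij (i j : 'I_n) F : 'M[R]_n -> R[i] := Dop (delta_mx i j) F.

(* [zip I (rot 1 I)] is (i_1,i_2), (i_2,i_3), ..., (i_m,i_1); [foldl] applies
   D_{i_1,i_2} to F first and D_{i_m,i_1} last, so that g is multiplied on the
   right by (1 + t_m E_{i_m,i_1}) ... (1 + t_1 E_{i_1,i_2}). *)
Definition Dcycle (I : seq 'I_n) F : 'M[R]_n -> R[i] :=
  foldl (fun H p => Dij p.1 p.2 H) F (zip I (rot 1 I)).

Definition casimir (m : nat) F : 'M[R]_n -> R[i] := fun g =>
  \sum_(I : m.-tuple 'I_n) Dcycle I F g.

Definition casimir_eigenvalue (m : nat) F (lam : R[i]) : Prop :=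
  forall g, g \in unitmx -> casimir m F g = lam * F g.

Definition iter_derive (f : 'M[R]_n -> R) (vs : seq 'M[R]_n) : 'M[R]_n -> R :=
  foldr (fun v h => fun g => 'D_v h g) f vs.

Definition smooth_on_GL (f : 'M[R]_n -> R) : Prop :=
  forall (vs : seq 'M[R]_n) g, g \in unitmx ->
    (forall v, derivable (iter_derive f vs) g v) /\
    {for g, continuous (iter_derive f vs)}.

Definition smoothC_on_GL F : Prop :=
  smooth_on_GL (fun g => complex.Re (F g)) /\
  smooth_on_GL (fun g => complex.Im (F g)).

End DifferentialOperators.

Section PowerFunction.
Variables (R : realType) (n : nat).

Definition unipotent_upper (x : 'M[R]_n) : Prop :=
  (forall i, x i i = 1) /\ (forall i j : 'I_n, (j < i)%N -> x i j = 0).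

Definition orthogonal_mx (k : 'M[R]_n) : Prop := k *m k^T = 1%:M.

Definition iwasawa_diag (g : 'M[R]_n) (Y : 'rV[R]_n) : Prop :=
  (forall i, 0 < Y 0 i) /\
  exists (c : R) (x k : 'M[R]_n),
    [/\ c != 0, unipotent_upper x, orthogonal_mx k &
        g = c *: (x *m diag_mx Y *m k)].

(* y ^ s = exp (s log y) for y > 0 and s complex *)
Definition cpow (y : R) (s : R[i]) : R[i] :=
  let a := complex.Re s * ln y in let b := complex.Im s * ln y in
  (expR a * cos b) +i* (expR a * sin b).

(* [iwasawa_diag g] determines Y up to a positive scalar, so the value does not
   depend on the choice made by [xget] as soon as \sum_i beta i = 0. *)
Definition power_fun (beta : 'I_n -> R[i]) (g : 'M[R]_n) : R[i] :=
  let Y := xget 0 [set Y : 'rV[R]_n | iwasawa_diag g Y] in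
  \prod_(i < n) cpow (Y 0 i) (beta i).

(* i : 'I_n is 0-based: the 1-based index is i.+1 *)
Definition rho (i : 'I_n) : R[i] := n.+1%:R / 2 - i.+1%:R.

End PowerFunction.

Section MaassForms.
Variables (R : realType) (n : nat).
Implicit Types (phi : 'M[R]_n -> R[i]) (g : 'M[R]_n).

Definition SLZ : set 'M[int]_n := [set gam | \det gam = 1].

Definition SLZ_invariant phi : Prop :=
  forall (gam : 'M[int]_n) g, SLZ gam -> g \in unitmx ->
    phi (map_mx intr gam *m g) = phi g.

Definition KZ_invariant phi : Prop :=
  (forall g k, g \in unitmx -> orthogonal_mx k -> phi (g *m k) = phi g) /\
  (forall g (c : R), g \in unitmx -> c != 0 -> phi (c *: g) = phi g).

(* Iterated Lebesgue integral of f over the entries listed in s, each ranging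
   over A; the other entries are those of a.  By Tonelli/Fubini this is the
   integral for the product Lebesgue measure. *)
Definition set_entry (a : 'M[R]_n) (p : 'I_n * 'I_n) (t : R) : 'M[R]_n :=
  \matrix_(i, j) if (i, j) == p then t else a i j.

Fixpoint integral_entries (s : seq ('I_n * 'I_n)) (A : set R)
    (f : 'M[R]_n -> \bar R) (a : 'M[R]_n) : \bar R :=
  if s is p :: s' then
    (\int[@lebesgue_measure R]_(t in A)
       integral_entries s' A f (set_entry a p t))%E
  else f a.

(* A standard parabolic subgroup is given by consecutive blocks, i.e. by a
   nondecreasing b : 'I_n -> nat, and is proper when b is not constant.  Its
   unipotent radical U consists of the u with u_ij = (i == j) unless b i < b j,
   and (U /\ SL(n,Z)) \ U is integrated over entries in [0, 1]. *)
Definition radical_entries (b : 'I_n -> nat) : seq ('I_n * 'I_n) :=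
  enum [pred p : 'I_n * 'I_n | (b p.1 < b p.2)%N].

Definition cuspidal phi : Prop :=
  forall b : 'I_n -> nat,
    {homo b : i j / (i <= j)%N >-> (i <= j)%N} ->
    (exists i j, b i != b j) ->
    forall g, g \in unitmx ->
      integral_entries (radical_entries b) `[0, 1]
        (fun u => (complex.Re (phi (u *m g)))%:E) 1%:M = 0%E /\
      integral_entries (radical_entries b) `[0, 1]
        (fun u => (complex.Im (phi (u *m g)))%:E) 1%:M = 0%E.

(* The points of h^n = G / (K Z(G)) are represented by the matrices x y with x
   upper unipotent and y positive diagonal with last diagonal entry 1. *)
Definition hn_point : set 'M[R]_n := [set z |
  [/\ forall i j : 'I_n, (j < i)%N -> z i j = 0,
      forall i, 0 < z i i &
      forall i : 'I_n, i.+1 = n -> z i i = 1]].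

(* a Borel set containing exactly one point of each SL(n,Z)-orbit on h^n *)
Definition fundamental_domain (D : set 'M[R]_n) : Prop :=
  [/\ (<<s [set U : set 'M[R]_n | open U] >>) D,
      D `<=` hn_point &
      forall g, g \in unitmx -> exists! z, D z /\
        exists (gam : 'M[int]_n) (c : R) (k : 'M[R]_n),
          [/\ SLZ gam, c != 0, orthogonal_mx k &
              g = c *: (map_mx intr gam *m z *m k)]].

(* Iwasawa coordinates on h^n: the entries a_ij (i < j) are those of x and the
   a_ii (i not last) are the Y_i; the entry Y_n = 1 is left untouched. *)
Definition hn_entries : seq ('I_n * 'I_n) :=
  enum [pred p : 'I_n * 'I_n |
    (p.1 < p.2)%N || ((p.1 == p.2) && (p.1.+1 != n))].

Definition hn_of_coords (a : 'M[R]_n) : 'M[R]_n :=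
  (\matrix_(i, j) if i == j then 1 else a i j) *m diag_mx (\row_i a i i).

(* Density of the G-invariant measure of h^n with respect to
   \prod_(i < j) dx_ij \prod_(i < n) dY_i.  With Y_i = y_1 ... y_(n - i) it is
   the measure \prod dx_ij \prod_(k < n) y_k ^ (- k (n - k) - 1) dy_k. *)
Definition hn_density (a : 'M[R]_n) : R :=
  (\prod_i (a i i)^-1) *
  (\prod_(p : 'I_n * 'I_n | (p.1 < p.2)%N) (a p.2 p.2 / a p.1 p.1)).

Definition sq_norm (w : R[i]) : R := complex.Re w ^+ 2 + complex.Im w ^+ 2.

Definition hn_integral_on (D : set 'M[R]_n) (f : 'M[R]_n -> R) : \bar R :=
  let E : set 'M[R]_n :=
    [set a : 'M[R]_n | (forall i, 0 < a i i) /\ D (hn_of_coords a)] in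
  integral_entries hn_entries setT
    (fun a => (\1_E a * (f (hn_of_coords a) * hn_density a))%:E) 1%:M.

Definition square_integrable phi : Prop :=
  exists2 D, fundamental_domain D &
    (hn_integral_on D (fun z => sq_norm (phi z)) < +oo)%E.

Record maass_form phi : Prop := MaassForm {
  maass_nonzero : exists2 g, g \in unitmx & phi g != 0;
  maass_smooth : smoothC_on_GL phi;
  maass_KZ : KZ_invariant phi;
  maass_SLZ : SLZ_invariant phi;
  maass_L2 : square_integrable phi;
  maass_cuspidal : cuspidal phi;
  maass_eigen : forall m, (1 <= m <= n)%N ->
    exists lam : R[i], casimir_eigenvalue m phi lam }.

Definition langlands_parameters phi (alpha : 'I_n -> R[i]) : Prop :=
  \sum_(l < n) alpha l = 0 /\
  forall m, (1 <= m <= n)%N -> exists lam : R[i],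
    casimir_eigenvalue m phi lam /\
    casimir_eigenvalue m (power_fun (fun i => alpha i + rho R i)) lam.

End MaassForms.

(* Main.v *)
(* The eigenvalue is read off from the power function F at the identity, where
   F = 1.  F is fixed by left multiplication by upper unipotent matrices and is
   multiplied by a character under left multiplication by positive diagonal
   ones; hence at the identity E_ij kills every derivative of F when i < j, and
   E_ii acts as the scalar beta_i.  Moving lower triangular E_ij to the right
   with the commutation relations of gl_n turns the sum of the cyclic words of
   length m into 1^T T^m 1, where T is the upper triangular matrix with all
   entries 1 above the diagonal and the diagonal
   beta_a - (n - a) = alpha_a - (n - 1) / 2.  A triangular recursion evaluates
   1^T T^m 1 through power sums of alpha.  The commutation relations need F to
   be smooth: prod_i Y_i^beta_i is a product of powers of the pivots of the
   Gaussian elimination of g g^T started from the last row. *)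
From HB Require Import structures.
Require Import Defs.
From mathcomp Require Import all_boot all_order all_algebra.
From mathcomp Require Import complex.
From mathcomp Require Import all_classical all_reals all_analysis.
From mathcomp Require Import ring.
Import Order.TTheory GRing.Theory Num.Theory.
Import numFieldNormedType.Exports.
Local Open Scope ring_scope.

Set Implicit Arguments.
Unset Strict Implicit.
Unset Printing Implicit Defensive.

(** * Cyclic words in the matrix units *)

(** Entry [a] of $T^m 1$, where $T$ is upper triangular with diagonal [d] and ones above it.
    Indexing by [nat] lets sums over indices be split as intervals. *)
Fixpoint cycle_value (C : comNzRingType) (n : nat) (d : nat -> C) (m a : nat) : C :=
  if m is m'.+1 then
    d a * cycle_value n d m' a + \sum_(a.+1 <= k < n) cycle_value n d m' k
  else 1.

Section CyclicWords.
Variables (C : comNzRingType) (V : zmodType) (n : nat).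
Variable (E : 'I_n -> 'I_n -> {additive V -> V}).

Local Notation apply_word := (foldl (fun h (p : 'I_n * 'I_n) => E p.1 p.2 h)).

(** Entry [(a, b)] of the [m]-th power of the operator matrix [E]: a sum over paths from [a] to [b]
    whose first edge acts first. *)
Fixpoint word_sum (m : nat) (a b : 'I_n) (v : V) : V :=
  if m is m'.+1 then \sum_k E k b (word_sum m' a k v) else v *+ (a == b).

Lemma sum_delta (f : 'I_n -> V) i : \sum_p f p *+ (p == i) = f i.
Proof. by rewrite (bigD1 i) //= eqxx big1 ?addr0 // => p /negPf ->. Qed.

Lemma word_sumS m a b v :
  word_sum m.+1 a b v = \sum_k word_sum m k b (E a k v).
Proof.
elim: m a b v => [|m IH] a b v.
  rewrite /= sum_delta -[RHS](sum_delta (fun k => E k b v)).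
  by apply: eq_bigr => k _; rewrite raddfMn eq_sym.
rewrite {1}/word_sum -/word_sum.
under eq_bigr => k _ do rewrite -/(word_sum m.+1 a k v) IH raddf_sum.
by rewrite exchange_big.
Qed.

Lemma sum_tuple_cons (W : zmodType) m (f : seq 'I_n -> W) :
  \sum_(s : m.+1.-tuple 'I_n) f s = \sum_a \sum_(s : m.-tuple 'I_n) f (a :: s).
Proof.
rewrite pair_big /=.
rewrite (reindex (fun p : 'I_n * m.-tuple 'I_n => cons_tuple p.1 p.2)) //=.
exists (fun s => (thead s, behead_tuple s)) => [[a s]|s] _ //=.
  by congr pair; apply: val_inj.
by rewrite [RHS]tuple_eta; apply: val_inj.
Qed.

(** The tuple [s] lists the interior vertices of a path from [a] to [b], so the word has one letter
    more than [s]. *)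
Lemma sum_zip_rcons m a b v :
  \sum_(s : m.-tuple 'I_n)
     apply_word v (zip (a :: s) (rcons s b)) =
  word_sum m.+1 a b v.
Proof.
elim: m a v => [|m IH] a v.
  rewrite (big_pred1 [tuple]) => [|s]; last by rewrite [s]tuple0 /= eqxx.
  by rewrite word_sumS /= sum_delta.
rewrite (sum_tuple_cons m (fun s => apply_word v (zip (a :: s) (rcons s b)))) /=.
by under eq_bigr => k _ do rewrite IH; rewrite -word_sumS.
Qed.

(** A cyclic word is a path closed at its first vertex, which produces the trace of the matrix
    power. *)
Lemma sum_zip_rot m v :
  \sum_(s : m.+1.-tuple 'I_n)
     apply_word v (zip s (rot 1 s)) =
  \sum_a word_sum m.+1 a a v.
Proof.
rewrite (sum_tuple_cons m (fun s => apply_word v (zip s (rot 1 s)))).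
by apply: eq_bigr => a _; rewrite -sum_zip_rcons; under eq_bigr do rewrite rot1_cons.
Qed.

Hypothesis E_comm : forall i j k l v,
  E i j (E k l v) = E k l (E i j v) + (E i l v *+ (j == k) - E k j v *+ (l == i)).

(** Commuting [E i j] through a word acts on one letter at a time. Contributions of neighbouring
    letters cancel at the interior vertices, so only the two ends remain. *)
Lemma word_sum_comm m i j k l v :
  E i j (word_sum m k l v) = word_sum m k l (E i j v)
    + (word_sum m i l v *+ (j == k) - word_sum m k j v *+ (l == i)).
Proof.
elim: m i j k l => [|m IH] i j k l /=.
  by rewrite raddfMn -!mulrnA !mulnb [j == k]eq_sym [i == l]eq_sym andbC subrr addr0.
(* The induction hypothesis solved for [word_sum m k p (E i j v)]. Its [p == i] term gives
   [E i l (word_sum m k j v)], which [E_comm] produces as well. *)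
have -> : \sum_p E p l (word_sum m k p (E i j v)) = 
  \sum_p (E p l (E i j (word_sum m k p v)) - E p l (word_sum m i p v) *+ (j == k)
   + E p l (word_sum m k j v) *+ (p == i)).
  apply: eq_bigr => p _; rewrite IH !raddfD raddfN !raddfMn /=.
  by rewrite !mulNrn addrA [X in X + _]addrAC addrK subrK.
rewrite raddf_sum big_split /= sumrB sumrMnl.
rewrite sum_delta; under eq_bigr do rewrite E_comm.
rewrite big_split /= sumrB sumrMnl.
under [X in _ + (X - _)]eq_bigr do rewrite eq_sym.
rewrite sum_delta.
by rewrite [RHS]addrA [in RHS](addrAC (\sum_p _)) subrK addrA.
Qed.

Variables (lam : {additive V -> C}) (beta : 'I_n -> C).
Hypothesis lam_upper : forall (i j : 'I_n) v, (i < j)%N -> lam (E i j v) = 0.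
Hypothesis lam_diag : forall i v, lam (E i i v) = beta i * lam v.

(** The last letter [E k b] is killed if [k < b] and acts as a scalar if [k = b]. If [b < k], it
    moves past the shorter word, and all ends that occur, [(a, k)] and [(a, b)], are again
    increasing. *)
Lemma lam_word_sum_upper m (a b : 'I_n) v : (a < b)%N -> lam (word_sum m a b v) = 0.
Proof.
elim: m a b v => [|m IH] a b v ab /=.
  by rewrite -val_eqE (ltn_eqF ab) raddf0.
rewrite raddf_sum big1 // => k _; case: (ltngtP k b) => [kb|bk|/val_inj->] /=.
- by rewrite lam_upper.
- rewrite word_sum_comm eqxx mulr1n !(raddfD, raddfN, raddfMn) /=.
  rewrite -val_eqE (gtn_eqF ab) mulr0n (IH a k) ?(ltn_trans ab) // (IH a b) //.
  by rewrite subr0 addr0.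
- by rewrite lam_diag IH ?mulr0.
Qed.

(** In the last letter [E k a], indices [k < a] contribute nothing and [k = a] contributes [beta a].
    Each of the [n - a.+1] indices [k > a] contributes the value at [k] minus the value at [a],
    whence the shift in [d]. *)
Lemma lam_word_sum_diag (d : nat -> C) :
    (forall a : 'I_n, d a = beta a - (n - a.+1)%:R) ->
  forall m a v, lam (word_sum m a a v) = cycle_value n d m a * lam v.
Proof.
move=> dE; elim=> [|m IH] a v /=; first by rewrite eqxx mul1r.
pose q := cycle_value n d m.
rewrite raddf_sum (bigID (fun k : 'I_n => (a < k)%N)) /= addrC.
rewrite (bigD1 a) ?ltnn //= lam_diag IH [X in _ + X + _]big1 => [|k]; last first.
  rewrite -leqNgt leq_eqVlt val_eqE => /andP[/orP[->//|ka] _].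
  by rewrite lam_upper.
rewrite addr0 (eq_bigr (fun k : 'I_n => q k * lam v - q a * lam v)); last first.
  move=> k ak; rewrite word_sum_comm !eqxx !mulr1n !(raddfD, raddfN) /= !IH.
  by rewrite lam_word_sum_upper // add0r.
rewrite sumrB sumr_const -mulr_suml big_geq_mkord /= -/q dE.
have -> : #|[pred k : 'I_n | (a < k)%N]| = (n - a.+1)%N.
  by rewrite -sum1_card -(big_geq_mkord _ _ xpredT (fun=> 1%N)) sum_nat_const_nat muln1.
by rewrite -mulr_natr; ring.
Qed.

Lemma lam_cyclic_words (d : nat -> C) m v :
    (forall a : 'I_n, d a = beta a - (n - a.+1)%:R) ->
  lam (\sum_(s : m.+1.-tuple 'I_n)
     apply_word v (zip s (rot 1 s))) =
  (\sum_(0 <= a < n) cycle_value n d m.+1 a) * lam v.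
Proof.
move=> dE; rewrite sum_zip_rot raddf_sum big_mkord mulr_suml.
by apply: eq_bigr => a _; rewrite (lam_word_sum_diag dE).
Qed.

End CyclicWords.

(** * Evaluation of the triangular recursion through power sums *)

Section PowerSums.
Variables (C : numFieldType) (n : nat).
Implicit Type d : nat -> C.

(* Coefficients of [u], ..., [u^5] in [exp (\sum_k L_k u^k)], where
   [L_k = \sum_a (d_a^k - (d_a - 1)^k) / k]; this is [\prod_a (1 + u / (1 - u d_a))],
   and [\sum_m u^(m+1) \sum_a cycle_value m a] is this product minus [1]. *)
Lemma sum_cycle_value d j : (j <= n)%N ->
  let q m := \sum_(j <= a < n) cycle_value n d m a in
  let P k := \sum_(j <= a < n) d a ^+ k in
  let L1 := (n - j)%:R : C in
  let L2 := P 1%N - L1 / 2 in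
  let L3 := P 2%N - P 1%N + L1 / 3 in
  let L4 := P 3%N - 3 / 2 * P 2%N + P 1%N - L1 / 4 in
  let L5 := P 4%N - 2 * P 3%N + 2 * P 2%N - P 1%N + L1 / 5 in
  [/\ q 0%N = L1,
      q 1%N = L2 + L1 ^+ 2 / 2,
      q 2%N = L3 + L1 * L2 + L1 ^+ 3 / 6,
      q 3%N = L4 + L1 * L3 + L2 ^+ 2 / 2 + L1 ^+ 2 * L2 / 2 + L1 ^+ 4 / 24
    & q 4%N = L5 + L1 * L4 + L2 * L3 + L1 ^+ 2 * L3 / 2 + L1 * L2 ^+ 2 / 2
              + L1 ^+ 3 * L2 / 6 + L1 ^+ 5 / 120].
Proof.
(* Induction on the number of summands, from the last index upwards, since the value at [a] involves
   only indices at least [a]. *)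
move=> jn; rewrite -(subKn jn); elim: (n - j)%N (leq_subr j n) => [|k IH] kn.
  rewrite subn0 subnn /= !big_geq //.
  by split; ring.
have kn' : (n - k.+1 < n)%N by rewrite ltn_subrL (leq_ltn_trans _ kn).
have {IH} := IH (ltnW kn); cbv beta zeta.
have PS p : \sum_(n - k.+1 <= a < n) d a ^+ p =
    d (n - k.+1)%N ^+ p + \sum_(n - k <= a < n) d a ^+ p.
  by rewrite (big_ltn kn') subnSK.
have q'S m : \sum_(n - k.+1 <= a < n) cycle_value n d m a =
    cycle_value n d m (n - k.+1) + \sum_(n - k <= a < n) cycle_value n d m a.
  by rewrite (big_ltn kn') subnSK.
have valS m : cycle_value n d m.+1 (n - k.+1) =
    d (n - k.+1)%N * cycle_value n d m (n - k.+1)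
    + \sum_(n - k <= a < n) cycle_value n d m a.
  by rewrite /= subnSK.
rewrite !PS !q'S !valS !subKn ?(ltnW kn) //= {PS q'S valS}.
move: (d _) (\sum_(_ <= a < n) d a ^+ 1) (\sum_(_ <= a < n) d a ^+ 2)
  (\sum_(_ <= a < n) d a ^+ 3) (\sum_(_ <= a < n) d a ^+ 4) => x p1 p2 p3 p4.
move: (\sum_(_ <= a < n) _) (\sum_(_ <= a < n) _) (\sum_(_ <= a < n) _)
  (\sum_(_ <= a < n) _) (\sum_(_ <= a < n) _) => q4 q3 q2 q1 q0.
case=> -> -> -> -> ->; rewrite -natr1; move: (k%:R) => N.
by split; field.
Qed.

(** The power sums of [d] expand binomially in those of [a], whose first one vanishes. Substitution
    leaves rational identities in [n] and three power sums. *)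
Lemma sum_cycle_value_shift (a d : nat -> C) :
    (forall k, (k < n)%N -> d k = a k - (n%:R - 1) / 2) ->
    \sum_(0 <= k < n) a k = 0 ->
  let q m := \sum_(0 <= k < n) cycle_value n d m k in
  let p j := \sum_(0 <= k < n) a k ^+ j in
  [/\ q 1%N = 0,
      q 2%N = p 2%N - (n%:R ^+ 3 - n%:R) / 12,
      q 3%N = p 3%N - n%:R / 2 * p 2%N + (n%:R ^+ 4 - n%:R ^+ 2) / 24
    & q 4%N = p 4%N - n%:R * p 3%N + 1 / 2 * p 2%N - (n%:R ^+ 5 - n%:R) / 80].
Proof.
move=> dE a0 q p; rewrite /q {q}.
have [_ -> -> -> ->] := sum_cycle_value d (leq0n n); rewrite subn0.
set c := (n%:R - 1) / 2 in dE.
have P1 : \sum_(0 <= k < n) d k ^+ 1 = - c * n%:R.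
  rewrite (eq_big_nat _ _ (F2 := fun k => a k - c)) ?sumrB ?a0 => [|k /andP[_ /dE ->]//].
  by rewrite sumr_const_nat subn0 -mulr_natr; ring.
have P2 : \sum_(0 <= k < n) d k ^+ 2 = p 2%N + c ^+ 2 * n%:R.
  rewrite (eq_big_nat _ _ (F2 := fun k => a k ^+ 2 + (- c * 2) * a k + c ^+ 2)).
    rewrite !big_split /= sumr_const_nat -mulr_sumr a0 subn0 -(mulr_natr (c ^+ 2)) /p.
    by ring.
  by move=> k /andP[_ /dE ->]; ring.
have P3 : \sum_(0 <= k < n) d k ^+ 3 = p 3%N - 3 * c * p 2%N - c ^+ 3 * n%:R.
  rewrite (eq_big_nat _ _ (F2 := fun k => a k ^+ 3 + (- 3 * c) * a k ^+ 2
    + (3 * c ^+ 2) * a k - c ^+ 3)).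
    rewrite sumrB !big_split /= sumr_const_nat -!mulr_sumr a0 subn0.
    rewrite -(mulr_natr (c ^+ 3)) /p.
    by ring.
  by move=> k /andP[_ /dE ->]; ring.
have P4 : \sum_(0 <= k < n) d k ^+ 4 =
    p 4%N - 4 * c * p 3%N + 6 * c ^+ 2 * p 2%N + c ^+ 4 * n%:R.
  rewrite (eq_big_nat _ _ (F2 := fun k => a k ^+ 4 + (- 4 * c) * a k ^+ 3
    + (6 * c ^+ 2) * a k ^+ 2 + (- 4 * c ^+ 3) * a k + c ^+ 4)).
    rewrite !big_split /= sumr_const_nat -!mulr_sumr a0 subn0 -(mulr_natr (c ^+ 4)) /p.
    by ring.
  by move=> k /andP[_ /dE ->]; ring.
rewrite P1 P2 P3 P4 /c; move: (p 2%N) (p 3%N) (p 4%N) (n%:R) => p2 p3 p4 N.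
by split; field.
Qed.

End PowerSums.

(** * Derivatives along one-parameter curves *)

Section ComplexDerivative.
Local Open Scope complex_scope.
Variable R : realType.
Implicit Types (u v : R -> R[i]) (l : R[i]).

Lemma ReD (x y : R[i]) : complex.Re (x + y) = complex.Re x + complex.Re y.
Proof. by case: x; case: y. Qed.

Lemma ImD (x y : R[i]) : complex.Im (x + y) = complex.Im x + complex.Im y.
Proof. by case: x; case: y. Qed.

Lemma ReM (x y : R[i]) : complex.Re (x * y) =
  complex.Re x * complex.Re y - complex.Im x * complex.Im y.
Proof. by case: x; case: y. Qed.

Lemma ImM (x y : R[i]) : complex.Im (x * y) =
  complex.Re x * complex.Im y + complex.Im x * complex.Re y.
Proof. by case: x; case: y. Qed.

(** Existence of the derivative is part of the predicate, whereas [Dop] only records the value of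
    [derive1]. *)
Definition is_Cderive u l :=
  is_derive (0 : R) (1 : R) (fun t => complex.Re (u t)) (complex.Re l) /\
  is_derive (0 : R) (1 : R) (fun t => complex.Im (u t)) (complex.Im l).

Lemma is_Cderive_cst l : is_Cderive (fun=> l) 0.
Proof. by split; apply: is_derive_cst. Qed.

Lemma is_CderiveD u v l l' :
  is_Cderive u l -> is_Cderive v l' -> is_Cderive (fun t => u t + v t) (l + l').
Proof.
move=> [ur ui] [vr vi]; split.
  rewrite ReD (_ : (fun t => _) = (fun t => complex.Re (u t)) + (fun t => complex.Re (v t))).
    exact: is_deriveD.
  by apply/funext => t; rewrite ReD.
rewrite ImD (_ : (fun t => _) = (fun t => complex.Im (u t)) + (fun t => complex.Im (v t))).
  exact: is_deriveD.
by apply/funext => t; rewrite ImD.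
Qed.

Lemma is_CderiveM u v l l' : is_Cderive u l -> is_Cderive v l' ->
  is_Cderive (fun t => u t * v t) (l * v 0 + u 0 * l').
Proof.
move=> [ur ui] [vr vi]; split.
  rewrite (_ : (fun t => _) = (fun t => complex.Re (u t)) * (fun t => complex.Re (v t))
     - (fun t => complex.Im (u t)) * (fun t => complex.Im (v t))); last first.
    by apply/funext => t; rewrite ReM.
  apply: is_derive_eq; rewrite ReD !ReM /GRing.scale /=; ring.
rewrite (_ : (fun t => _) = (fun t => complex.Re (u t)) * (fun t => complex.Im (v t))
   + (fun t => complex.Im (u t)) * (fun t => complex.Re (v t))); last first.
  by apply/funext => t; rewrite ImM.
apply: is_derive_eq; rewrite ImD !ImM /GRing.scale /=; ring.
Qed.

Lemma eq_is_Cderive u v l : u =1 v -> is_Cderive u l -> is_Cderive v l.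
Proof. by move=> /funext ->. Qed.

Lemma near_is_Cderive u v l :
  (\forall t \near (0 : R), u t = v t) -> is_Cderive u l -> is_Cderive v l.
Proof.
move=> uv [ur ui]; split.
  by apply: near_eq_is_derive ur; apply: filterS uv => t ->.
by apply: near_eq_is_derive ui; apply: filterS uv => t ->.
Qed.

(** Makes division by a positive function an instance of [cpow], so elimination quotients and
    complex powers are treated alike. *)
Lemma cpowN1 (y : R) : 0 < y -> cpow y (-1) = (y^-1)%:C.
Proof.
move=> y0; rewrite /cpow /= oppr0 mul0r cos0 sin0 mulr1 mulr0 mulN1r expRN.
by rewrite lnK.
Qed.

Lemma cpowD (y : R) (s t : R[i]) : cpow y (s + t) = cpow y s * cpow y t.
Proof.
rewrite /cpow ReD ImD !mulrDl expRD cosD sinD; simpc.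
by congr (_ +i* _); ring.
Qed.

Lemma cpow0 (y : R) : cpow y 0 = 1.
Proof. by rewrite /cpow /= !mul0r expR0 cos0 sin0 mulr0 mul1r. Qed.

Lemma cpow1x (s : R[i]) : cpow 1 s = 1.
Proof. by rewrite /cpow ln1 !mulr0 expR0 cos0 sin0 mulr0 mulr1. Qed.

Lemma cpow_sum (I : finType) (y : R) (s : I -> R[i]) :
  cpow y (\sum_i s i) = \prod_i cpow y (s i).
Proof. exact: (big_morph _ (cpowD y) (cpow0 y)). Qed.

Lemma cpowM (x y : R) (s : R[i]) : 0 < x -> 0 < y ->
  cpow (x * y) s = cpow x s * cpow y s.
Proof.
move=> x0 y0; rewrite /cpow lnM // !mulrDr expRD cosD sinD; simpc.
by congr (_ +i* _); ring.
Qed.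

Lemma is_Cderive_cpow (d : R -> R) (s l : R[i]) :
    0 < d 0 -> is_Cderive (fun t => (d t)%:C) l ->
  is_Cderive (fun t => cpow (d t) s) (s * l * cpow (d 0) (-1) * cpow (d 0) s).
Proof.
move=> d0 [/= dr di]; rewrite cpowN1 //.
(* The imaginary part of the curve is constantly zero, hence so is its derivative. *)
have Il : complex.Im l = 0.
  by have [_ <-] := di; rewrite derive_cst.
have dln : is_derive (0 : R) (1 : R) (@ln R \o d) ((d 0)^-1 * complex.Re l).
  by apply: is_derive1_comp; exact: is_derive1_ln.
have dlin (a : R) : is_derive (0 : R) (1 : R) (fun t => a * ln (d t))
    (a * ((d 0)^-1 * complex.Re l)).
  exact: (is_deriveZ a dln).
have dexp := @is_derive1_comp _ expR _ 0 _ _ (is_derive_expR _) (dlin (complex.Re s)).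
have dcos := @is_derive1_comp _ cos _ 0 _ _ (is_derive_cos _) (dlin (complex.Im s)).
have dsin := @is_derive1_comp _ sin _ 0 _ _ (is_derive_sin _) (dlin (complex.Im s)).
split.
  have -> : (fun t => complex.Re (cpow (d t) s)) =
     (expR \o (fun t => complex.Re s * ln (d t))) * (cos \o (fun t => complex.Im s * ln (d t))).
    by [].
  apply: is_derive_eq; rewrite !(ReM, ImM) /cpow /= Il /GRing.scale /=; ring.
have -> : (fun t => complex.Im (cpow (d t) s)) =
     (expR \o (fun t => complex.Re s * ln (d t))) * (sin \o (fun t => complex.Im s * ln (d t))).
  by [].
apply: is_derive_eq; rewrite !(ReM, ImM) /cpow /= Il /GRing.scale /=; ring.
Qed.

End ComplexDerivative.

(** * Functions on the general linear group closed under the derivations *)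

Section ElementaryFunctions.
Local Open Scope complex_scope.
Variables (R : realType) (n : nat).
Local Notation M := 'M[R]_n.
Implicit Types (f h : M -> R[i]) (g X : M) (i j k l : 'I_n).

Definition curve g X (t : R) : M := g *m (1%:M + t *: X).

Lemma curve0 g X : curve g X 0 = g.
Proof. by rewrite /curve scale0r addr0 mulmx1. Qed.

(** The determinant of [1%:M + t *: X] is a polynomial in [t] with value 1 at 0, so it stays nonzero
    near 0. *)
Lemma near_unitmx_curve g X : g \in unitmx ->
  \forall t \near (0 : R), curve g X t \in unitmx.
Proof.
move=> gU; pose p := \det (1%:M + 'X *: map_mx polyC X).
have pE t : \det (1%:M + t *: X) = p.[t].
  rewrite -[RHS]/(horner_eval t p) -det_map_mx; congr (\det _).
  apply/matrixP => i j; rewrite !mxE -[RHS]/(_.[t]) hornerD hornerM hornerX !hornerC.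
  by rewrite hornerMn hornerC.
have p0 : p.[0] != 0 by rewrite -pE scale0r addr0 det1 oner_neq0.
apply: filterS (cvgr_neq0 _ (@continuous_horner R p 0) p0) => t /= pt.
by rewrite unitmx_mul gU unitmxE pE unitfE.
Qed.

Lemma is_Cderive_Dop f g X (l : R[i]) :
  is_Cderive (fun t => f (curve g X t)) l -> Dop X f g = l.
Proof.
by move=> [ur ui]; rewrite /Dop !derive1E !derive_val; case: l {ur ui}.
Qed.

Lemma is_Cderive_lin g X i (v : 'cV[R]_n) :
  is_Cderive (fun t => ((curve g X t *m v) i 0)%:C) ((g *m (X *m v)) i 0)%:C.
Proof.
split => /=; last exact: is_derive_cst.
have -> : (fun t => (curve g X t *m v) i 0) =
  cst ((g *m v) i 0) + (((g *m (X *m v)) i 0) \*: (id : R -> R)).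
  apply/funext => t; rewrite /curve mulmxDr mulmx1 mulmxDl -scalemxAr -scalemxAl.
  by rewrite -mulmxA mxE; congr (_ + _); rewrite mxE mulrC.
by apply: is_derive_eq; rewrite add0r /GRing.scale /= mulr1.
Qed.

Lemma Dop_unit f h X g : {in unitmx, f =1 h} -> g \in unitmx ->
  Dop X f g = Dop X h g.
Proof.
move=> fh gU; rewrite /Dop !derive1E.
by congr (_ +i* _); apply: near_eq_derive;
  apply: filterS (near_unitmx_curve X gU) => t tU; rewrite -/(curve g X t) fh.
Qed.

(* A class closed under [Dop] and rich enough for the power function, so that all
   iterated derivatives exist and the commutators reduce to the generators. *)
Inductive elementary : (M -> R[i]) -> Prop :=
| elementary_cst c : elementary (fun=> c)
| elementary_lin i (v : 'cV[R]_n) : elementary (fun g => ((g *m v) i 0)%:C)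
| elementaryD f h : elementary f -> elementary h -> elementary (f \+ h)
| elementaryM f h : elementary f -> elementary h -> elementary (f \* h)
| elementary_cpow (d : M -> R) s : elementary (fun g => (d g)%:C) ->
    (forall g, g \in unitmx -> 0 < d g) -> elementary (fun g => cpow (d g) s)
| elementary_eq f h : elementary f -> {in unitmx, f =1 h} -> elementary h.

(** An explicit derivative is exhibited inside the class, so one induction yields both existence and
    closure under [Dop]. *)
Lemma elementary_derivative X f : elementary f ->
  exists2 df, elementary df &
    {in unitmx, forall g, is_Cderive (fun t => f (curve g X t)) (df g)}.
Proof.
elim=> {f}.
- move=> c; exists (fun=> 0); first exact: elementary_cst.
  by move=> g _; apply: is_Cderive_cst.
- move=> i v; exists (fun g => ((g *m (X *m v)) i 0)%:C); first exact: elementary_lin.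
  by move=> g _; exact: is_Cderive_lin.
- move=> f h _ [df df_e dfE] _ [dh dh_e dhE].
  exists (fun g => df g + dh g); first exact: elementaryD.
  by move=> g gU; apply: is_CderiveD; [exact: dfE | exact: dhE].
- move=> f h f_e [df df_e dfE] h_e [dh dh_e dhE].
  exists (fun g => df g * h g + f g * dh g).
    by apply: elementaryD; exact: elementaryM.
  move=> g gU; have := is_CderiveM (dfE g gU) (dhE g gU).
  by rewrite curve0.
- move=> d s d_e [dd dd_e ddE] d_pos.
  exists (fun g => s * dd g * cpow (d g) (-1) * cpow (d g) s).
    do !apply: elementaryM => //; do ?exact: elementary_cpow.
    exact: elementary_cst.
  move=> g gU; have := @is_Cderive_cpow _ (fun t => d (curve g X t)) s (dd g).
  by rewrite curve0; apply; [exact: d_pos | exact: ddE].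
- move=> f h f_e [df df_e dfE] fh; exists df => // g gU.
  apply: near_is_Cderive (dfE g gU).
  by apply: filterS (near_unitmx_curve X gU) => t tU; apply: fh.
Qed.

Lemma elementary_is_Cderive X f g : elementary f -> g \in unitmx ->
  is_Cderive (fun t => f (curve g X t)) (Dop X f g).
Proof.
move=> /(elementary_derivative X)[df _ dfE] gU.
by rewrite (is_Cderive_Dop (dfE _ gU)); exact: dfE.
Qed.

Lemma elementary_Dop X f : elementary f -> elementary (Dop X f).
Proof.
move=> /(elementary_derivative X)[df df_e dfE]; apply: elementary_eq df_e _.
by move=> g gU; rewrite (is_Cderive_Dop (dfE _ gU)).
Qed.

Lemma DopD X f h g : elementary f -> elementary h -> g \in unitmx ->
  Dop X (f \+ h) g = Dop X f g + Dop X h g.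
Proof.
move=> f_e h_e gU; apply: is_Cderive_Dop.
by apply: is_CderiveD; exact: elementary_is_Cderive.
Qed.

Lemma DopM X f h g : elementary f -> elementary h -> g \in unitmx ->
  Dop X (f \* h) g = Dop X f g * h g + f g * Dop X h g.
Proof.
move=> f_e h_e gU; apply: is_Cderive_Dop.
have := is_CderiveM (elementary_is_Cderive X f_e gU) (elementary_is_Cderive X h_e gU).
by rewrite curve0.
Qed.

Lemma Dop_cst X (c : R[i]) g : Dop X (fun=> c) g = 0.
Proof. by apply: is_Cderive_Dop; apply: is_Cderive_cst. Qed.

Lemma Dop_lin X i (v : 'cV[R]_n) g :
  Dop X (fun g => ((g *m v) i 0)%:C) g = ((g *m (X *m v)) i 0)%:C.
Proof. by apply: is_Cderive_Dop; exact: is_Cderive_lin. Qed.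

Lemma Dop_cpow X (d : M -> R) s g : elementary (fun g => (d g)%:C) ->
    (forall g, g \in unitmx -> 0 < d g) -> g \in unitmx ->
  Dop X (fun g => cpow (d g) s) g =
  s * Dop X (fun g => (d g)%:C) g * cpow (d g) (-1) * cpow (d g) s.
Proof.
move=> d_e d_pos gU; apply: is_Cderive_Dop.
have := @is_Cderive_cpow _ (fun t => d (curve g X t)) s (Dop X (fun g => (d g)%:C) g).
by rewrite curve0; apply; [exact: d_pos | exact: (elementary_is_Cderive X d_e)].
Qed.

End ElementaryFunctions.

(** * Commutation relations of the matrix-unit derivations *)

Section DerivationCommutator.
Local Open Scope complex_scope.
Variables (R : realType) (n : nat).
Local Notation M := 'M[R]_n.
Variable E : 'I_n -> 'I_n -> (M -> R[i]) -> M -> R[i].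
Implicit Types (f h : M -> R[i]) (g : M) (i j k l : 'I_n).
Hypothesis E_elementary : forall i j f, elementary f -> elementary (E i j f).
Hypothesis E_unit : forall i j f h g, {in unitmx, f =1 h} -> g \in unitmx ->
  E i j f g = E i j h g.
Hypothesis ED : forall i j f h g, elementary f -> elementary h -> g \in unitmx ->
  E i j (f \+ h) g = E i j f g + E i j h g.
Hypothesis EM : forall i j f h g, elementary f -> elementary h -> g \in unitmx ->
  E i j (f \* h) g = E i j f g * h g + f g * E i j h g.
Hypothesis E_cst : forall i j (c : R[i]), E i j (fun=> c) = fun=> 0.
Hypothesis E_lin : forall i j a (v : 'cV[R]_n),
  E i j (fun g => ((g *m v) a 0)%:C) = fun g => ((g *m (delta_mx i j *m v)) a 0)%:C.
Hypothesis E_cpow : forall i j (d : M -> R) s g, elementary (fun g => (d g)%:C) ->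
    (forall g, g \in unitmx -> 0 < d g) -> g \in unitmx ->
  E i j (fun g => cpow (d g) s) g =
  s * E i j (fun g => (d g)%:C) g * cpow (d g) (-1) * cpow (d g) s.

(** A commutator of derivations is a derivation, so the identity propagates from linear functions,
    where it is the multiplication rule of matrix units, along the constructors of [elementary]. *)
Lemma derivation_comm f : elementary f -> forall i j k l, {in unitmx, forall g,
  E i j (E k l f) g = E k l (E i j f) g
    + (E i l f g *+ (j == k) - E k j f g *+ (l == i))}.
Proof.
elim=> {f}.
- move=> c i j k l g _.
  by rewrite !E_cst !mul0rn subrr addr0.
- move=> a v i j k l g _.
  rewrite !E_lin -!raddfMn -raddfB -raddfD /=; congr (_%:C).
  have L0 : (g *m ((0 : M) *m v)) a 0 = 0 by rewrite mul0mx mulmx0 mxE.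
  rewrite !(mulmxA (delta_mx _ _)) !mul_delta_mx_cond.
  by case: (j == k); case: (l == i); rewrite ?mulr1n ?mulr0n ?L0; ring.
- move=> f h f_e IHf h_e IHh i j k l g gU.
  have EE i' j' k' l' : E i' j' (E k' l' (f \+ h)) g =
      E i' j' (E k' l' f) g + E i' j' (E k' l' h) g.
    rewrite (@E_unit _ _ _ (E k' l' f \+ E k' l' h)) // => [|g' g'U]; last exact: ED.
    by rewrite ED //; exact: E_elementary.
  rewrite !EE !ED // IHf // IHh // !mulrnDl.
  ring.
- move=> f h f_e IHf h_e IHh i j k l g gU.
  (* The two mixed products of first derivatives are exchanged when the operators are swapped, so
     they cancel in the commutator. *)
  have EE i' j' k' l' : E i' j' (E k' l' (f \* h)) g =
      E i' j' (E k' l' f) g * h g + E k' l' f g * E i' j' h g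
      + (E i' j' f g * E k' l' h g + f g * E i' j' (E k' l' h) g).
    have fE := E_elementary k' l' f_e; have hE := E_elementary k' l' h_e.
    rewrite (@E_unit _ _ _ (E k' l' f \* h \+ f \* E k' l' h)) //; last first.
      by move=> g' g'U; exact: EM.
    by rewrite ED ?EM //; exact: elementaryM.
  rewrite !EE !EM // IHf // IHh // !mulrnDl.
  ring.
- move=> d s d_e IHd d_pos i j k l g gU.
  set D : M -> R[i] := fun g => (d g)%:C in d_e IHd.
  pose p z : M -> R[i] := fun g => cpow (d g) z.
  have pE z : elementary (p z) by exact: elementary_cpow.
  have EpE z i' j' g' : g' \in unitmx ->
      E i' j' (p z) g' = z * E i' j' D g' * p (-1) g' * p z g'.
    exact: E_cpow.
  have cE := elementary_cst n s.
  rewrite -/(p s).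
  clearbody p D.
  (* The term quadratic in first derivatives of [D] is symmetric in the two operators and cancels.
     The commutator on [D] remains, times the common factor. *)
  have EE i' j' k' l' : E i' j' (E k' l' (p s)) g = p (-1) g * p s g * s *
      (E i' j' (E k' l' D) g + (s - 1) * p (-1) g * E i' j' D g * E k' l' D g).
    have DE := E_elementary k' l' d_e.
    rewrite (@E_unit _ _ _ ((((fun=> s) \* E k' l' D) \* p (-1)) \* p s)) //; last first.
      by move=> g' g'U; exact: EpE.
    rewrite !EM ?E_cst ?EpE //; do ?[exact: elementaryM | apply: elementaryM => //].
    by rewrite /=; ring.
  rewrite !EE !EpE // IHd //.
  ring.
- move=> f h f_e IHf fh i j k l g gU.
  have EE i' j' : {in unitmx, E i' j' h =1 E i' j' f}.
    by move=> g' g'U; apply: E_unit g'U => g'' g''U; rewrite fh.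
  by rewrite !EE // !(E_unit _ _ (EE _ _)) // IHf.
Qed.

End DerivationCommutator.

Lemma Dij_comm (R : realType) (n : nat) (f : 'M[R]_n -> R[i]) (i j k l : 'I_n) :
  elementary f -> {in unitmx, forall g,
  Dij i j (Dij k l f) g = Dij k l (Dij i j f) g
    + (Dij i l f g *+ (j == k) - Dij k j f g *+ (l == i))}.
Proof.
move=> f_e; apply: derivation_comm => // {f f_e i j k l}; rewrite /Dij.
- by move=> i j f; exact: elementary_Dop.
- by move=> i j f h g; exact: Dop_unit.
- by move=> i j f h g; exact: DopD.
- by move=> i j f h g; exact: DopM.
- by move=> i j c; apply/funext => g; exact: Dop_cst.
- by move=> i j a v; apply/funext => g; exact: Dop_lin.
- by move=> i j d s g; exact: Dop_cpow.
Qed.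

(** * The Iwasawa decomposition *)

Section Pivots.
Local Open Scope complex_scope.
Variables (R : realType) (n' : nat).
Local Notation n := n'.+1.
Local Notation M := 'M[R]_n.
Implicit Types (A B g x : M) (i j p q : 'I_n) (u v w : 'rV[R]_n).

(** The Schur complement of entry [(q, q)], kept at full size: for a nonzero pivot, row and column
    [q] become zero. *)
Definition eliminate q B : M := \matrix_(i, j) (B i j - B i q * B q j / B q q).

(* Eliminates the last [k] indices, starting from index [n']. *)
Fixpoint schur A (k : nat) : M :=
  if k is k'.+1 then eliminate (inord (n' - k')) (schur A k') else A.

(** After [n' - p] steps exactly the indices above [p] have been eliminated. *)
Definition pivot A p : R := schur A (n' - p) p p.

Lemma val_pivot_index (k : nat) : (k < n)%N -> ((inord (n' - k) : 'I_n) + k)%N = n'.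
Proof. by move=> kn; rewrite inordK ?ltnS ?leq_subr // subnK. Qed.

(** Eliminating [q] removes precisely the rank-one term [p = q] of $A = x D x^T$: the other
    remaining terms have [p < q], where [x q p = 0]. *)
Lemma schur_LDL A x (D : 'I_n -> R) :
    unipotent_upper x -> (forall p, D p != 0) ->
    (forall i j, A i j = \sum_p x i p * D p * x j p) ->
  forall k, (k <= n)%N -> forall i j,
    schur A k i j = \sum_(p < n | (p + k < n)%N) x i p * D p * x j p.
Proof.
move=> [x1 x0] D0 AE; elim=> [_ i j|k IH kn i j].
  by rewrite /= AE; apply: eq_bigl => p; rewrite addn0 ltn_ord.
rewrite /= mxE; set q := inord _; have qk : (q + k)%N = n' by exact: val_pivot_index.
have ltnE p : (p + k < n)%N = (p <= q)%N by rewrite ltnS -(leq_add2r k p q) qk.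
have x0q p : (p + k < n)%N && (p != q) -> x q p = 0.
  by rewrite ltnE => /andP[pq npq]; rewrite x0 // ltn_neqAle npq.
have colE i' : schur A k i' q = x i' q * D q.
  rewrite IH ?(ltnW kn) // (bigD1 q) /= ?ltnE // x1 mulr1 big1 ?addr0 // => p /x0q->.
  by rewrite mulr0.
have rowE j' : schur A k q j' = D q * x j' q.
  rewrite IH ?(ltnW kn) // (bigD1 q) /= ?ltnE // x1 mul1r big1 ?addr0 // => p /x0q->.
  by rewrite !mul0r.
rewrite !colE rowE x1 IH ?(ltnW kn) // (bigD1 q) /= ?ltnE //.
rewrite (_ : _ / _ = x i q * D q * x j q); last by field; rewrite D0.
rewrite addrAC subrr add0r; apply: eq_bigl => p.
by rewrite ltnE andbC -val_eqE -ltn_neqAle addnS ltnS -(ltn_add2r k p q) qk.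
Qed.

(** Uniqueness of $D$ in $x D x^T$. Of the terms left at entry [(p, p)], those with index below [p]
    vanish by triangularity. *)
Lemma pivot_LDL A x (D : 'I_n -> R) p :
    unipotent_upper x -> (forall p, D p != 0) ->
    (forall i j, A i j = \sum_p x i p * D p * x j p) -> pivot A p = D p.
Proof.
move=> xU D0 AE; have [x1 x0] := xU.
rewrite /pivot (schur_LDL xU D0 AE) ?(leq_trans (leq_subr _ _)) //.
have pn : (p <= n')%N by rewrite -ltnS.
have ltnE q : (q + (n' - p) < n)%N = (q <= p)%N.
  by rewrite ltnS -(leq_add2r (n' - p) q p) subnKC.
rewrite (bigD1 p) /= ?ltnE // !x1 mulr1 mul1r big1 ?addr0 // => q.
by rewrite ltnE => /andP[qp nqp]; rewrite (x0 p) ?mulr0 // ltn_neqAle nqp.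
Qed.

Definition bilin B u v : R := (u *m B *m v^T) 0 0.

Lemma bilinBZl B u v w (c : R) : bilin B (u - c *: v) w = bilin B u w - c * bilin B v w.
Proof. by rewrite /bilin !mulmxBl -!scalemxAl !mxE. Qed.

Lemma bilinBZr B u v w (c : R) : bilin B u (v - c *: w) = bilin B u v - c * bilin B u w.
Proof. by rewrite /bilin linearB /= linearZ /= mulmxBr -!scalemxAr !mxE. Qed.

Lemma bilinC B u v : B^T = B -> bilin B u v = bilin B v u.
Proof.
move=> BT; rewrite /bilin -[u *m B *m v^T]trmxK mxE.
by rewrite !trmx_mul trmxK BT mulmxA.
Qed.

Lemma bilin_delta B p q : bilin B (delta_mx 0 p) (delta_mx 0 q) = B p q.
Proof. by rewrite /bilin trmx_delta -rowE -colE !mxE. Qed.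

Lemma bilin_eliminate q B v : bilin (eliminate q B) v v =
  bilin B v v - bilin B v (delta_mx 0 q) * bilin B (delta_mx 0 q) v / B q q.
Proof.
have -> : eliminate q B = B - (B q q)^-1 *: (col q B *m row q B).
  by apply/matrixP => i j; rewrite !mxE big_ord1 !mxE mulrC.
rewrite /bilin mulmxBr mulmxBl -scalemxAr -scalemxAl trmx_delta.
rewrite -[_ *m _ *m delta_mx q 0]mulmxA -colE -rowE mulmxA -[v *m B *m _]mulmxA.
rewrite -(mulmxA (v *m _)); move: (v *m _) (row q B *m _) (v *m _) => a b d.
by rewrite !mxE big_ord1 mulrC.
Qed.

(** Elimination puts the eliminated basis vectors into the kernel, so definiteness can persist only
    on the span of the first [m] ones. *)
Definition posdef_below (m : nat) B := forall v, v != 0 ->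
  (forall i, (m <= i)%N -> v 0 i = 0) -> 0 < bilin B v v.

Lemma posdef_below_diag m B q : (q < m)%N -> posdef_below m B -> 0 < B q q.
Proof.
move=> qm /(_ (delta_mx 0 q)); rewrite bilin_delta; apply => [|i mi].
  by apply/eqP => /matrixP/(_ 0 q)/eqP; rewrite !mxE !eqxx oner_eq0.
by rewrite mxE eqxx andTb; case: eqP => // iq; rewrite iq leqNgt qm in mi.
Qed.

Lemma eliminate_posdef q B : B^T = B -> posdef_below q.+1 B ->
  posdef_below q (eliminate q B).
Proof.
move=> Bsym Bpos v v0 vq.
have Bqq := posdef_below_diag (leqnn _) Bpos.
(* The vector v is replaced by its component B-orthogonal to e_q. *)
pose c := bilin B v (delta_mx 0 q) / B q q.
have := Bpos (v - c *: delta_mx 0 q).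
rewrite bilinBZl !bilinBZr bilin_delta bilin_eliminate.
rewrite [bilin B (delta_mx 0 q) v]bilinC //.
rewrite (_ : _ - c * (_ - c * _) = 
  bilin B v v - bilin B v (delta_mx 0 q) * bilin B v (delta_mx 0 q) / B q q); last first.
  by rewrite /c; field; rewrite gt_eqF.
apply=> [|i qi].
  apply: contraNneq v0 => w0; apply/eqP/rowP => i.
  have := congr1 (fun u : 'rV_n => u 0 i) w0; rewrite !mxE eqxx andTb.
  case: eqP => [->|_]; first by rewrite vq.
  by rewrite mulr0 subr0.
rewrite !mxE vq ?(ltnW qi) // eqxx andTb.
case: eqP => [iq|_]; last by rewrite mulr0 subr0.
by rewrite iq ltnn in qi.
Qed.

Lemma schur_posdef A k : A^T = A -> posdef_below n A -> (k <= n)%N ->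
  [/\ (schur A k)^T = schur A k, posdef_below (n - k) (schur A k) &
      forall i j, (n <= i + k)%N -> schur A k i j = 0].
Proof.
move=> Asym Apos; elim: k => [_|k IH kn].
  rewrite subn0; split=> // i j.
  by rewrite addn0 leqNgt ltn_ord.
have [Bsym Bpos B0] := IH (ltnW kn).
have qk := val_pivot_index kn; set q := inord _ in qk.
have nk : (n - k)%N = q.+1 by rewrite subSn // inordK // ltnS leq_subr.
rewrite nk in Bpos; have Bqq := posdef_below_diag (leqnn _) Bpos.
rewrite /= -/q; split.
- have BE i j : schur A k i j = schur A k j i by rewrite -{1}Bsym mxE.
  apply/matrixP => i j; rewrite !mxE (BE j i) (BE j q) (BE q i).
  by rewrite (mulrC (schur A k q j)).
- by rewrite subSS -qk addnK; exact: eliminate_posdef.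
- have leE i : (n <= i + k.+1)%N = (q <= i)%N.
    by rewrite addnS ltnS -(leq_add2r k q i) qk.
  move=> i j; rewrite mxE leE leq_eqVlt.
  case/orP => [/eqP/val_inj <-|qi]; first by rewrite mulrAC divff ?gt_eqF // mul1r subrr.
  move: qi; rewrite -(ltn_add2r k q i) qk => qi.
  have Bi0 j' : schur A k i j' = 0 by rewrite B0.
  by rewrite !Bi0 !mul0r subrr.
Qed.

Lemma pivot_gt0 A p : A^T = A -> posdef_below n A -> 0 < pivot A p.
Proof.
move=> Asym Apos; have pn : (p <= n')%N by rewrite -ltnS.
have kn : (n' - p <= n)%N by rewrite (leq_trans (leq_subr _ _)).
have [_ Bpos _] := schur_posdef Asym Apos kn.
by apply: posdef_below_diag Bpos; rewrite subSn ?leq_subr // subKn.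
Qed.

(** The successive Schur complements differ by rank-one matrices, and these telescope to [A]. *)
Lemma exists_LDL A : A^T = A -> posdef_below n A ->
  exists2 x, unipotent_upper x &
    forall i j, A i j = \sum_p x i p * pivot A p * x j p.
Proof.
move=> Asym Apos; have piv0 p := lt0r_neq0 (pivot_gt0 p Asym Apos).
(* Column [p] is the column about to be eliminated, divided by its pivot. Rows below [p] are already
   zero. *)
exists (\matrix_(i, p) (schur A (n' - p) i p / pivot A p)).
  split=> [i|i j ji]; rewrite mxE; first exact: divff (piv0 i).
  have jn : (j <= n')%N by rewrite -ltnS.
  have kn : (n' - j <= n)%N by rewrite (leq_trans (leq_subr _ _)).
  have [_ _ ->] := schur_posdef Asym Apos kn; first by rewrite mul0r.
  by move: ji; rewrite -(ltn_add2r (n' - j) j i) subnKC.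
move=> i j.
(* For [k = n] the Schur complement is zero and the sum runs over all indices. *)
have step k : (k <= n)%N -> A i j = schur A k i j + \sum_(p < n | (n <= p + k)%N)
    schur A (n' - p) i p * schur A (n' - p) j p / pivot A p.
  elim: k => [_|k IH kn].
    by rewrite big_pred0 ?addr0 // => p; rewrite addn0 leqNgt ltn_ord.
  rewrite (IH (ltnW kn)) /= mxE.
  have qk := val_pivot_index kn; set q := inord _ in qk *.
  have kE : k = (n' - q)%N by apply: (@addnI q); rewrite qk subnKC // -ltnS.
  have [Bsym _ _] := schur_posdef Asym Apos (ltnW kn).
  rewrite [X in _ = _ + X](bigD1 q) /= ?addnS ?qk ?leqnn // /pivot -kE.
  have BE : schur A k q j = schur A k j q by rewrite -{1}Bsym mxE.
  rewrite BE addrA subrK; congr (_ + _); apply: eq_bigl => p.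
  have -> : (n <= p + k)%N = (q < p)%N by rewrite -(ltn_add2r k q p) qk.
  have -> : (n <= p + k.+1)%N = (q <= p)%N.
    by rewrite addnS ltnS -(leq_add2r k q p) qk.
  by rewrite ltn_neqAle andbC eq_sym.
have [_ _ S0] := schur_posdef Asym Apos (leqnn n).
rewrite (step n) // S0 ?leq_addl // add0r; apply: eq_big => [p|p _].
  by rewrite leq_addl.
by rewrite !mxE divfK // mulrA.
Qed.

End Pivots.

(** * Left translations in Iwasawa coordinates *)

Section UnipotentDiagonal.
Local Open Scope complex_scope.
Variables (R : realType) (n : nat).
Local Notation M := 'M[R]_n.
Implicit Types (g x : M) (i j p : 'I_n) (a Y : 'rV[R]_n).

Lemma unipotent_upper1 : unipotent_upper (1%:M : M).
Proof.
by split=> [i|i j ji]; rewrite mxE ?eqxx // -val_eqE gtn_eqF.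
Qed.

Lemma unipotent_upperM x y :
  unipotent_upper x -> unipotent_upper y -> unipotent_upper (x *m y).
Proof.
move=> [x1 x0] [y1 y0]; split=> [i|i j ji]; rewrite mxE.
  rewrite (bigD1 i) //= x1 y1 mulr1 big1 ?addr0 // => k ki.
  have /orP[lt|lt] : (k < i)%N || (i < k)%N by rewrite -neq_ltn.
    by rewrite x0 ?mul0r.
  by rewrite y0 ?mulr0.
rewrite big1 // => k _; case: (ltnP k i) => [ki|ik]; first by rewrite x0 ?mul0r.
by rewrite y0 ?mulr0 // (leq_trans ji).
Qed.

Lemma unipotent_upper_unit x : unipotent_upper x -> x \in unitmx.
Proof.
move=> [x1 x0]; rewrite -unitmx_tr unitmxE det_trig.
  by rewrite big1 ?unitr1 // => i _; rewrite mxE.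
by apply/is_trig_mxP => i j ij; rewrite mxE x0.
Qed.

Lemma diag_unit a : (forall i, 0 < a 0 i) -> diag_mx a \in unitmx.
Proof.
move=> a0; rewrite unitmxE det_diag unitfE; apply/prodf_neq0 => i _.
by rewrite gt_eqF.
Qed.

Lemma iwasawa_diag_unipotent g x Y :
  unipotent_upper x -> iwasawa_diag g Y -> iwasawa_diag (x *m g) Y.
Proof.
move=> xU [Y0 [c [x' [k [c0 x'U kO ->]]]]]; split=> //.
exists c, (x *m x'), k; split=> //; first exact: unipotent_upperM.
by rewrite -scalemxAr !mulmxA.
Qed.

Lemma iwasawa_diag_diag g a Y : (forall i, 0 < a 0 i) ->
  iwasawa_diag g Y -> iwasawa_diag (diag_mx a *m g) (\row_i (a 0 i * Y 0 i)).
Proof.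
move=> a0 [Y0 [c [x [k [c0 [x1 x0] kO ->]]]]]; split=> [i|].
  by rewrite mxE mulr_gt0.
(* Conjugating [x] by [diag_mx a] keeps it upper unipotent and moves the diagonal factor next to
   [diag_mx Y]. *)
exists c, (\matrix_(i, j) (a 0 i * x i j / a 0 j)), k; split=> //.
  split=> [i|i j ji]; rewrite mxE; first by rewrite x1 mulr1 divff ?gt_eqF.
  by rewrite x0 // mulr0 mul0r.
rewrite -scalemxAr !mulmxA; congr (_ *: (_ *m _)).
apply/matrixP => i j; rewrite mul_diag_mx !mul_mx_diag !mxE.
by field; rewrite gt_eqF.
Qed.

Lemma iwasawa_diag1 : iwasawa_diag (1%:M : M) (const_mx 1).
Proof.
split=> [i|]; first by rewrite mxE.
exists 1, 1%:M, 1%:M; split; rewrite ?oner_neq0 //; first exact: unipotent_upper1.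
  by rewrite /orthogonal_mx mul1mx trmx1.
by rewrite scale1r mul1mx mulmx1 diag_const_mx.
Qed.

End UnipotentDiagonal.

(** * The power function as a product of powers of pivots *)

Section PowerFunction.
Local Open Scope complex_scope.
Variables (R : realType) (n' : nat).
Local Notation n := n'.+1.
Local Notation M := 'M[R]_n.
Implicit Types (g x : M) (i j p : 'I_n) (a Y : 'rV[R]_n).

Lemma gram_sym g : (g *m g^T)^T = g *m g^T.
Proof. by rewrite trmx_mul trmxK. Qed.

Lemma gram_posdef g : g \in unitmx -> posdef_below n (g *m g^T).
Proof.
move=> gU v v0 _; rewrite /bilin mulmxA -mulmxA -trmx_mul.
have vg0 : v *m g != 0 by apply: contraNneq v0 => vg0; rewrite -(mulmxK gU v) vg0 mul0mx.
move: (v *m g) vg0 => w w0; rewrite mxE; under eq_bigr do rewrite mxE -expr2.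
rewrite lt0r sumr_ge0 ?andbT => [|i _]; last exact: sqr_ge0.
apply: contraNneq w0 => sum0; apply/eqP/rowP => i; rewrite mxE; apply/eqP.
rewrite -sqrf_eq0; apply/eqP; apply: (psumr_eq0P _ sum0) => // j _.
exact: sqr_ge0.
Qed.

Lemma pivot_gram_gt0 g p : g \in unitmx -> 0 < pivot (g *m g^T) p.
Proof. by move=> gU; apply: pivot_gt0; [exact: gram_sym | exact: gram_posdef]. Qed.

(** Square roots of the pivots of $g g^T$ give [h = x *m diag_mx Y] with $h h^T = g g^T$, so $h^{-1}
    g$ is orthogonal. *)
Lemma iwasawa_exists g : g \in unitmx -> exists Y, iwasawa_diag g Y.
Proof.
move=> gU; have [x xU gE] := exists_LDL (gram_sym g) (gram_posdef gU).
pose Y : 'rV_n := \row_p Num.sqrt (pivot (g *m g^T) p).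
have Y0 p : 0 < Y 0 p by rewrite mxE sqrtr_gt0 pivot_gram_gt0.
pose h := x *m diag_mx Y.
have hU : h \in unitmx by rewrite unitmx_mul unipotent_upper_unit // diag_unit.
have hh : h *m h^T = g *m g^T.
  apply/matrixP => i j; rewrite gE mxE; apply: eq_bigr => p _.
  rewrite [h^T p j]mxE /h mul_mx_diag !mxE.
  rewrite mulrACA -expr2 sqr_sqrtr ?ltW ?pivot_gram_gt0 //; ring.
exists Y; split=> //; exists 1, x, (invmx h *m g); split=> //.
  rewrite /orthogonal_mx trmx_mul mulmxA -(mulmxA _ g) -hh trmx_inv.
  by rewrite (mulmxA (invmx h)) mulVmx // mul1mx mulmxV // unitmx_tr.
by rewrite scale1r -/h mulKVmx.
Qed.

(** The orthogonal factor drops out of $g g^T$, leaving a decomposition with diagonal $(cY)^2$, and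
    pivots are unique. *)
Lemma pivot_iwasawa g Y : iwasawa_diag g Y ->
  exists2 c : R, c != 0 & forall p, pivot (g *m g^T) p = (c * Y 0 p) ^+ 2.
Proof.
move=> [Y0 [c [x [k [c0 xU kO ->]]]]]; exists c => // p.
apply: (pivot_LDL (D := fun p => (c * Y 0 p) ^+ 2)) xU _ _.
  by move=> q; rewrite expf_neq0 // mulf_neq0 // gt_eqF.
move=> i j; rewrite linearZ /= !trmx_mul -scalemxAl -scalemxAr.
rewrite -(mulmxA (x *m diag_mx Y)) (mulmxA k) kO mul1mx tr_diag_mx.
rewrite mulmxA -(mulmxA x) mulmx_diag mul_mx_diag scalerA mxE [X in _ * X]mxE.
by rewrite mulr_sumr; apply: eq_bigr => q _; rewrite !mxE; ring.
Qed.

(** Pivots are squares, hence the halved exponents, and the unknown factor [c ^+ 2] is raised to a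
    total exponent 0. As the right side does not mention [Y], the choice of [Y] is immaterial. *)
Lemma prod_cpow_iwasawa (beta : 'I_n -> R[i]) g Y : \sum_i beta i = 0 ->
  iwasawa_diag g Y -> \prod_i cpow (Y 0 i) (beta i) =
    \prod_i cpow (pivot (g *m g^T) i) (beta i / 2).
Proof.
move=> beta0 YE; have [c c0 pE] := pivot_iwasawa YE.
have c2 : 0 < c ^+ 2 by rewrite exprn_even_gt0 ?c0.
have cE i : cpow (pivot (g *m g^T) i) (beta i / 2) =
    cpow (c ^+ 2) (beta i / 2) * cpow (Y 0 i) (beta i).
  have Y0 : 0 < Y 0 i by case: YE.
  have -> : pivot (g *m g^T) i = c ^+ 2 * (Y 0 i * Y 0 i) by rewrite pE; ring.
  rewrite (cpowM _ c2 (mulr_gt0 Y0 Y0)) (cpowM _ Y0 Y0) -cpowD.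
  by congr (_ * cpow _ _); field.
under [RHS]eq_bigr do rewrite cE.
have c1 : \prod_i cpow (c ^+ 2) (beta i / 2) = 1.
  by rewrite -(cpow_sum (c ^+ 2)) -mulr_suml beta0 mul0r cpow0.
by rewrite big_split /= c1 mul1r.
Qed.

Lemma power_funE (beta : 'I_n -> R[i]) g Y : \sum_i beta i = 0 ->
  iwasawa_diag g Y -> power_fun beta g = \prod_i cpow (Y 0 i) (beta i).
Proof.
move=> beta0 YE; rewrite (prod_cpow_iwasawa beta0 YE).
rewrite -(@prod_cpow_iwasawa _ _ (xget 0 [set Z | iwasawa_diag g Z]%classic)) //.
exact: (@xgetPex _ 0 [set Z | iwasawa_diag g Z]%classic (ex_intro _ Y YE)).
Qed.

Lemma power_fun_pivot (beta : 'I_n -> R[i]) g : \sum_i beta i = 0 -> g \in unitmx ->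
  power_fun beta g = \prod_i cpow (pivot (g *m g^T) i) (beta i / 2).
Proof.
move=> beta0 /iwasawa_exists[Y YE]; rewrite (power_funE beta0 YE).
exact: prod_cpow_iwasawa.
Qed.

Lemma power_fun_unipotent (beta : 'I_n -> R[i]) x g : \sum_i beta i = 0 ->
  unipotent_upper x -> g \in unitmx -> power_fun beta (x *m g) = power_fun beta g.
Proof.
move=> beta0 xU /iwasawa_exists[Y YE].
by rewrite (power_funE beta0 YE) (power_funE beta0 (iwasawa_diag_unipotent xU YE)).
Qed.

Lemma power_fun_diag (beta : 'I_n -> R[i]) a g : \sum_i beta i = 0 ->
    (forall i, 0 < a 0 i) -> g \in unitmx ->
  power_fun beta (diag_mx a *m g) = (\prod_i cpow (a 0 i) (beta i)) * power_fun beta g.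
Proof.
move=> beta0 a0 /iwasawa_exists[Y YE].
rewrite (power_funE beta0 YE) (power_funE beta0 (iwasawa_diag_diag a0 YE)).
rewrite -big_split; apply: eq_bigr => i _.
by rewrite mxE cpowM //; case: YE.
Qed.

Lemma power_fun1 (beta : 'I_n -> R[i]) :
  \sum_i beta i = 0 -> power_fun beta (1%:M : M) = 1.
Proof.
move=> beta0; rewrite (power_funE beta0 (iwasawa_diag1 R n)).
by rewrite big1 // => i _; rewrite mxE cpow1x.
Qed.

Lemma elementary_sum (I : Type) (r : seq I) (f : I -> M -> R[i]) :
  (forall k, elementary (f k)) -> elementary (fun g => \sum_(i <- r) f i g).
Proof.
move=> f_e; elim: r => [|i r IH].
  by apply: elementary_eq (elementary_cst n 0) _ => g _; rewrite big_nil.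
by apply: elementary_eq (elementaryD (f_e i) IH) _ => g _; rewrite big_cons.
Qed.

Lemma elementary_prod (I : Type) (r : seq I) (f : I -> M -> R[i]) :
  (forall k, elementary (f k)) -> elementary (fun g => \prod_(i <- r) f i g).
Proof.
move=> f_e; elim: r => [|i r IH].
  by apply: elementary_eq (elementary_cst n 1) _ => g _; rewrite big_nil.
by apply: elementary_eq (elementaryM (f_e i) IH) _ => g _; rewrite big_cons.
Qed.

Lemma elementary_entry i j : elementary (fun g : M => (g i j)%:C).
Proof.
apply: elementary_eq (elementary_lin i (delta_mx j 0)) _ => g _.
by rewrite -colE mxE.
Qed.

(** Every division is by a pivot of $g g^T$, which is positive on invertible [g], so
    [elementary_cpow] with exponent -1 applies. *)
Lemma elementary_schur k i j : (k <= n')%N ->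
  elementary (fun g : M => (schur (g *m g^T) k i j)%:C).
Proof.
elim: k i j => [|k IH] i j kn /=.
  apply: elementary_eq (elementary_sum _ (fun p =>
    elementaryM (elementary_entry i p) (elementary_entry j p))) _ => g _ /=.
  by rewrite mxE raddf_sum; apply: eq_bigr => p _; rewrite -rmorphM mxE.
have {}IH i j := IH i j (ltnW kn); set q := inord _.
have qk : (q + k)%N = n' by rewrite val_pivot_index // ltnW.
have pivE g : schur (g *m g^T) k q q = pivot (g *m g^T) q.
  rewrite /pivot (_ : (n' - q)%N = k) //.
  by apply: (@addnI q); rewrite qk subnKC // -ltnS.
have piv0 g : g \in unitmx -> 0 < schur (g *m g^T) k q q.
  by move=> gU; rewrite pivE pivot_gram_gt0.
apply: elementary_eq (elementaryD (IH i j) (elementaryM (elementary_cst n (-1))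
  (elementaryM (elementaryM (IH i q) (IH q j))
    (elementary_cpow (-1) (IH q q) piv0)))) _ => g gU.
by rewrite /= mxE cpowN1 ?piv0 // rmorphB !rmorphM mulN1r.
Qed.

Lemma elementary_power_fun (beta : 'I_n -> R[i]) :
  \sum_i beta i = 0 -> elementary (power_fun beta : M -> R[i]).
Proof.
move=> beta0.
have pE p : elementary (fun g : M => cpow (pivot (g *m g^T) p) (beta p / 2)).
  apply: elementary_cpow => [|g gU]; last exact: pivot_gram_gt0.
  by apply: elementary_schur; rewrite leq_subr.
apply: elementary_eq (elementary_prod _ pE) _ => g gU.
by rewrite power_fun_pivot.
Qed.

End PowerFunction.

(** * The module generated by the power function *)

Section EquivariantFunctions.
Local Open Scope complex_scope.
Variables (R : realType) (n : nat) (beta : 'I_n -> R[i]).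
Local Notation M := 'M[R]_n.
Implicit Types (f h : M -> R[i]) (g x : M) (i j : 'I_n) (a : 'rV[R]_n).

(* Vanishing outside GL(n, R) turns equality on GL(n, R) into Leibniz equality. *)
Definition equivariant f : Prop :=
  [/\ elementary f, forall g, g \notin unitmx -> f g = 0,
      forall x g, unipotent_upper x -> g \in unitmx -> f (x *m g) = f g &
      forall a g, (forall i, 0 < a 0 i) -> g \in unitmx ->
        f (diag_mx a *m g) = (\prod_i cpow (a 0 i) (beta i)) * f g].

Definition equivariant_pred : {pred M -> R[i]} := fun f => `[< equivariant f >].

Lemma equivariant_zmod_closed : zmod_closed equivariant_pred.
Proof.
split=> [|f h /asboolP[f1 f2 f3 f4] /asboolP[h1 h2 h3 h4]]; apply/asboolP; split.
- exact: (elementary_cst n 0).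
- by [].
- by [].
- by move=> a g _ _; rewrite mulr0.
- apply: elementary_eq (elementaryD f1 (elementaryM (elementary_cst n (-1)) h1)) _.
  by move=> g _ /=; rewrite mulN1r.
- by move=> g gU; rewrite !fctE f2 // h2 // subrr.
- by move=> x g xU gU; rewrite !fctE f3 // h3.
- by move=> a g a0 gU; rewrite !fctE f4 // h4 // mulrBr.
Qed.

HB.instance Definition _ :=
  GRing.isZmodClosed.Build (M -> R[i]) equivariant_pred equivariant_zmod_closed.

Record equivariant_fun :=
  EquivariantFun { equivariant_val :> M -> R[i];
                   _ : equivariant_val \in equivariant_pred }.

HB.instance Definition _ := [isSub for equivariant_val].
HB.instance Definition _ := [Choice of equivariant_fun by <:].
HB.instance Definition _ := [SubChoice_isSubZmodule of equivariant_fun by <:].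

Definition Dij0 i j f : M -> R[i] := fun g => if g \in unitmx then Dij i j f g else 0.

(** The derivation moves [g] by right multiplication, which commutes with left translations. *)
Lemma Dij0_equivariant i j f : equivariant f -> equivariant (Dij0 i j f).
Proof.
case=> f1 f2 f3 f4; have D1 := elementary_is_Cderive (delta_mx i j) f1.
have uM y g : y \in unitmx -> g \in unitmx -> y *m g \in unitmx.
  by move=> yU gU; rewrite unitmx_mul yU.
have curveM y g t : curve (y *m g) (delta_mx i j) t = y *m curve g (delta_mx i j) t.
  by rewrite /curve mulmxA.
have nearU g : g \in unitmx -> _ := near_unitmx_curve (delta_mx i j).
split.
- apply: elementary_eq (elementary_Dop (delta_mx i j) f1) _ => g gU.
  by rewrite /Dij0 gU.
- by move=> g /negPf gU; rewrite /Dij0 gU.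
- move=> x g xU gU; rewrite /Dij0 gU (uM _ _ (unipotent_upper_unit xU) gU).
  apply: is_Cderive_Dop; apply: near_is_Cderive (D1 g gU).
  by apply: filterS (nearU g gU) => t tU; rewrite curveM (f3 x).
- move=> a g a0 gU; rewrite /Dij0 gU (uM _ _ (diag_unit a0) gU).
  apply: is_Cderive_Dop; set c := \prod_i _.
  have := is_CderiveM (is_Cderive_cst c) (D1 g gU); rewrite mul0r add0r.
  apply: near_is_Cderive.
  by apply: filterS (nearU g gU) => t tU; rewrite curveM (f4 a).
Qed.

Lemma equivariant_funP (v : equivariant_fun) : equivariant v.
Proof. exact/asboolP/(valP v). Qed.

Definition Dij_op i j (v : equivariant_fun) : equivariant_fun :=
  EquivariantFun (introT (asboolP _) (Dij0_equivariant i j (equivariant_funP v))).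

Lemma Dij_opE i j v g : g \in unitmx -> Dij_op i j v g = Dij i j v g.
Proof. by move=> gU; rewrite /= /Dij0 gU. Qed.

Lemma equivariant_eq (v w : equivariant_fun) : {in unitmx, v =1 w} -> v = w.
Proof.
move=> vw; apply: val_inj; apply/funext => g /=.
have [gU|gU] := boolP (g \in unitmx); first exact: vw.
by case: (equivariant_funP v) => _ -> // _ _; case: (equivariant_funP w) => _ ->.
Qed.

Lemma Dij_op_zmod_morphism i j : zmod_morphism (Dij_op i j).
Proof.
move=> v w; apply: equivariant_eq => g gU.
have [v1 _ _ _] := equivariant_funP v; have [w1 _ _ _] := equivariant_funP w.
rewrite [RHS]/= !fctE !Dij_opE // /Dij0 gU; apply: is_Cderive_Dop.
have := is_CderiveD (elementary_is_Cderive (delta_mx i j) v1 gU)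
  (is_CderiveM (is_Cderive_cst (-1)) (elementary_is_Cderive (delta_mx i j) w1 gU)).
rewrite mul0r add0r mulN1r; apply: eq_is_Cderive => t.
by rewrite mulN1r.
Qed.

HB.instance Definition _ i j := GRing.isZmodMorphism.Build
  equivariant_fun equivariant_fun (Dij_op i j) (Dij_op_zmod_morphism i j).

Definition eval1 (v : equivariant_fun) : R[i] := v 1%:M.

Lemma eval1_zmod_morphism : zmod_morphism eval1.
Proof. by []. Qed.

HB.instance Definition _ := GRing.isZmodMorphism.Build
  equivariant_fun R[i] eval1 eval1_zmod_morphism.

Lemma Dij_op_comm i j k l v :
  Dij_op i j (Dij_op k l v) = Dij_op k l (Dij_op i j v)
    + (Dij_op i l v *+ (j == k) - Dij_op k j v *+ (l == i)).
Proof.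
apply: equivariant_eq => g gU.
have natmulE (w : equivariant_fun) m : (w *+ m) g = w g *+ m.
  by elim: m => [//|m IH]; rewrite !mulrS -IH.
have DopE i' j' k' l' : Dij_op i' j' (Dij_op k' l' v) g = Dij i' j' (Dij k' l' v) g.
  rewrite Dij_opE //; apply: Dop_unit gU => g' g'U; exact: Dij_opE.
transitivity (Dij_op k l (Dij_op i j v) g
    + ((Dij_op i l v *+ (j == k)) g - (Dij_op k j v *+ (l == i)) g)); last by [].
have [v1 _ _ _] := equivariant_funP v.
rewrite !natmulE (DopE i j) (DopE k l) (Dij_opE i l) // (Dij_opE k j) //.
exact: Dij_comm v1 g gU.
Qed.

(** For [i < j] the curve through the identity consists of upper unipotent matrices, along which [v]
    is constant. *)
Lemma eval1_upper i j v : (i < j)%N -> eval1 (Dij_op i j v) = 0.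
Proof.
move=> ij; rewrite /eval1 Dij_opE ?unitmx1 //; apply: is_Cderive_Dop.
have [_ _ v3 _] := equivariant_funP v.
apply: eq_is_Cderive (is_Cderive_cst (v 1%:M)) => t.
rewrite /curve mul1mx -[in RHS](mulmx1 (_ + _)) v3 ?unitmx1 //; split=> [k|k l lk].
  rewrite !mxE eqxx -!val_eqE /=; case: eqP => [->|_]; rewrite ?mulr0 ?addr0 //.
  by rewrite (ltn_eqF ij) mulr0 addr0.
rewrite !mxE -!val_eqE /= (gtn_eqF lk) add0r.
case: eqP => [ki|_]; case: eqP => [lj|_]; rewrite ?mulr0 //.
by move: lk; rewrite ki lj ltnNge ltnW.
Qed.

(** Near [t = 0] the curve is positive diagonal and [v] equals $(1+t)^{\beta_i}$ times its value at
    the identity. *)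
Lemma eval1_diag i v : eval1 (Dij_op i i v) = beta i * eval1 v.
Proof.
rewrite /eval1 Dij_opE ?unitmx1 //; apply: is_Cderive_Dop.
have [_ _ _ v4] := equivariant_funP v.
have d1t : is_Cderive (fun t : R => (1 + t)%:C) 1.
  split => /=; last exact: is_derive_cst.
  rewrite (_ : (fun t : R => 1 + t) = cst 1 + id) //.
  by apply: is_derive_eq; rewrite add0r.
have := is_Cderive_cpow (beta i) _ d1t; rewrite addr0 => /(_ ltr01).
rewrite !cpow1x !mulr1 => dcpow; have := is_CderiveM dcpow (is_Cderive_cst (v 1%:M)).
rewrite mulr0 addr0; apply: near_is_Cderive.
have near_pos : \forall t \near (0 : R), 0 < 1 + t.
  apply: filterS (nbhs0_lt (@ltr01 R)) => t; rewrite ltr_norml => /andP[t1 _].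
  by rewrite -ltrBlDl sub0r.
apply: filterS near_pos => t t0.
pose a : 'rV[R]_n := \row_j (if j == i then 1 + t else 1).
have -> : curve 1%:M (delta_mx i i) t = diag_mx a *m 1%:M.
  rewrite /curve mul1mx mulmx1; apply/matrixP => k l; rewrite !mxE.
  have [<-|kl] := eqVneq k l; first by case: (k == i); rewrite ?mulr1 ?mulr0 ?addr0.
  by case: (k =P i) => [<-|_]; rewrite ?[l == k]eq_sym ?(negPf kl) mulr0 addr0.
rewrite v4 ?unitmx1 // => [|k]; last by rewrite mxE; case: eqP.
congr (_ * _); rewrite (bigD1 i) //= mxE eqxx big1 ?mulr1 // => k /negPf ki.
by rewrite mxE ki cpow1x.
Qed.

End EquivariantFunctions.

(** * The Casimir eigenvalue of the power function at the identity *)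

Section PowerFunctionEigenvalue.
Variables (R : realType) (n' : nat) (beta : 'I_n'.+1 -> R[i]).
Hypothesis beta0 : \sum_i beta i = 0.
Local Notation M := 'M[R]_n'.+1.

Definition power_fun0 (g : M) : R[i] := if g \in unitmx then power_fun beta g else 0.

Lemma power_fun0_equivariant : equivariant beta power_fun0.
Proof.
have uM (y g : M) : y \in unitmx -> g \in unitmx -> y *m g \in unitmx.
  by move=> yU gU; rewrite unitmx_mul yU.
rewrite /power_fun0; split=> [|g /negPf->|x g xU gU|a g a0 gU] //.
- by apply: elementary_eq (elementary_power_fun beta0) _ => g ->.
- by rewrite gU (uM _ _ (unipotent_upper_unit xU) gU) power_fun_unipotent.
- by rewrite gU (uM _ _ (diag_unit a0) gU) power_fun_diag.
Qed.

Lemma foldl_Dij_op (z : seq ('I_n'.+1 * 'I_n'.+1)) (f : M -> R[i])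
    (v : equivariant_fun beta) : {in unitmx, f =1 v} ->
  {in unitmx, foldl (fun h p => Dij p.1 p.2 h) f z
    =1 foldl (fun h p => Dij_op p.1 p.2 h) v z}.
Proof.
elim: z f v => [//|p z IH] f v fv; apply: IH => g gU.
by rewrite Dij_opE //; exact: Dop_unit.
Qed.

Lemma casimir_power_fun (d : nat -> R[i]) m :
    (forall a : 'I_n'.+1, d a = beta a - (n'.+1 - a.+1)%:R) ->
  casimir m.+1 (power_fun beta) (1%:M : M) =
    \sum_(0 <= a < n'.+1) cycle_value n'.+1 d m.+1 a.
Proof.
move=> dE; pose v := EquivariantFun (introT (asboolP _) power_fun0_equivariant).
have v1 : eval1 v = 1 by rewrite /eval1 /= /power_fun0 unitmx1 power_fun1.
have := @lam_cyclic_words _ _ _ _ (@Dij_op_comm _ _ beta) (@eval1 _ _ beta)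
  beta (@eval1_upper _ _ beta) (@eval1_diag _ _ beta) d m v dE.
rewrite [X in _ = _ * X]v1 mulr1 => <-; rewrite raddf_sum; apply: eq_bigr => s _.
apply: foldl_Dij_op; last exact: unitmx1.
by move=> g gU; rewrite /= /power_fun0 gU.
Qed.

End PowerFunctionEigenvalue.

(** * Transfer of the eigenvalue to Maass forms *)

Theorem theorem1p1 (R : realType) (n : nat) (hn : (2 <= n)%N)
    (phi : 'M[R]_n -> R[i]) (alpha : 'I_n -> R[i])
    (hphi : maass_form phi) (halpha : langlands_parameters phi alpha)
    (m : nat) (hm : (1 <= m <= n)%N) (hm4 : (m <= 4)%N)
    (g : 'M[R]_n) (hg : g \in unitmx) :
  [/\ m = 1%N -> casimir m phi g = 0,
      m = 2%N -> casimir m phi g =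
        ((\sum_(l < n) alpha l ^+ 2) - (n%:R ^+ 3 - n%:R) / 12) * phi g,
      m = 3%N -> casimir m phi g =
        ((\sum_(l < n) alpha l ^+ 3) - n%:R / 2 * (\sum_(l < n) alpha l ^+ 2)
         + (n%:R ^+ 4 - n%:R ^+ 2) / 24) * phi g
    & m = 4%N -> casimir m phi g =
        ((\sum_(l < n) alpha l ^+ 4) - n%:R * (\sum_(l < n) alpha l ^+ 3)
         + 1 / 2 * (\sum_(l < n) alpha l ^+ 2)
         - (n%:R ^+ 5 - n%:R) / 80) * phi g].
Proof.
case: n hn phi alpha hphi halpha hm g hg => [//|n'] _ phi alpha _ [alpha0 eigen] hm g hg.
have [lam [phiE powE]] := eigen m hm.
set beta := fun i => _ in powE.
(* The entries of [rho] sum to $n(n+1)/2 - \binom{n+1}{2} = 0$. *)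
have beta0 : \sum_i beta i = 0.
  rewrite big_split /= alpha0 add0r sumrB sumr_const card_ord.
  rewrite -natr_sum; under eq_bigr do rewrite -add1n.
  rewrite big_split /= sum_nat_const card_ord muln1.
  rewrite -(big_mkord xpredT (fun i => i)) bin2_sum.
  have := bin_ffact n'.+2 2; rewrite binS bin1 ffactnS ffactn1 addnC.
  move=> /(congr1 (@GRing.natmul R[i] 1)).
  rewrite !natrM -[_ *+ n'.+1]mulr_natr !mulr1 => binE.
  by rewrite -[X in _ - X](mulfK (_ : 2 != 0)) ?pnatr_eq0 // binE /=; field.
(* In [rho k - (n - k.+1)] the index cancels, leaving the constant $-(n-1)/2$ of [d]. *)
pose a k := alpha (inord k); pose d k := a k - (n'.+1%:R - 1) / 2.
have dE (k : 'I_n'.+1) : d k = beta k - (n'.+1 - k.+1)%:R.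
  rewrite /d /a inord_val /beta /rho natrB // -!natr1.
  by field.
have sumE j : \sum_(l < n'.+1) alpha l ^+ j = \sum_(0 <= k < n'.+1) a k ^+ j.
  by rewrite big_mkord; apply: eq_bigr => k _; rewrite /a inord_val.
have a0 : \sum_(0 <= k < n'.+1) a k = 0.
  by rewrite big_mkord -[RHS]alpha0; apply: eq_bigr => k _; rewrite /a inord_val.
have [q1 q2 q3 q4] := @sum_cycle_value_shift _ _ a d (fun _ _ => erefl) a0.
rewrite phiE // !sumE.
(* The eigenvalue equation of the power function is evaluated at the identity, where that function
   is 1. The same [lam] is the eigenvalue on [phi]. *)
have lamE j : m = j.+1 -> lam = \sum_(0 <= k < n'.+1) cycle_value n'.+1 d j.+1 k.
  move=> mE; have := powE 1%:M (unitmx1 _ _).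
  by rewrite mE (casimir_power_fun beta0 _ dE) power_fun1 // mulr1 => ->.
by split=> /lamE ->; rewrite ?q1 ?q2 ?q3 ?q4 ?mul0r.
Qed.
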